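(* Let $\mathcal{F}(P_f,\cdot,\cdot)$ be a fairness risk, and suppose it takes values in $[0,C]$, where $C>0$ is a constant. Let $\mathcal{E}$ be the expected fairness risk and let $\hat{\mathcal{E}}_n(Z_1,\ldots,Z_N)=\frac1N\sum_{s=1}^N \mathcal{F}(P_f,Z_s)$ be its Monte Carlo estimator based on $N$ i.i.d. samples $Z_1,\ldots,Z_N$ of labels and demographics (all as defined in the context). Then for all $\epsilon>0$, $$P\left(\left|\hat{\mathcal{E}}_n(Z_1,\ldots,Z_N)-\mathcal{E}\right|\ge \epsilon\right)\le 2\exp\left(-2N\epsilon^2/C^2\right).$$ As a result, for every $\delta\in(0,1)$, to guarantee an estimation error of $\epsilon$ with confidence $1-\delta$ (that is, $P(|\hat{\mathcal{E}}_n(Z_1,\ldots,Z_N)-\mathcal{E}|\ge\epsilon)\le\delta$), it suffices to draw $N=\frac{C^2}{2\epsilon^2}\log\frac{2}{\delta}$ samples (rounded up to an integer).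
   Context: Fix $n$ training examples with nonsensitive features $x_1,\ldots,x_n$ in a feature space $\mathcal{X}$, observed labels $\tilde y_i$ and observed demographics $\tilde a_i$; each of $\tilde y_i,\tilde a_i$ may take the value $\emptyset$ (unavailable). The true label $Y_i$ and true demographic (sensitive feature) $A_i$ take values in finite sets (e.g. $\{0,1\}$). A classifier $f$ is fixed; it induces conditional distributions $P_f(\hat Y\mid x)$ of the predicted label. A fairness risk is a real-valued function $\mathcal{F}(P_f,y_{1:n},a_{1:n})$ of the classifier, a vector of labels $y_{1:n}=(y_1,\ldots,y_n)$ and a vector of demographics $a_{1:n}=(a_1,\ldots,a_n)$; for $Z=\{(a_i,y_i)\}_{i=1}^n$ write $\mathcal{F}(P_f,Z)=\mathcal{F}(P_f,y_{1:n},a_{1:n})$. Fixed imputation distributions are given: $q_\phi(A\mid x_i,\tilde a_i)$ for the demographic of example $i$, and $P_g(Y\mid x_i)$ for the label of example $i$ when $\tilde y_i=\emptyset$; when $\tilde y_i\neq\emptyset$, $Y_i$ is fixed to the observed label $\tilde y_i$. All the $A_i$ and $Y_i$ are drawn independently. The expected fairness risk is $$\mathcal{E}=\mathbb{E}_{\{Y_i\sim P_g(Y\mid x_i):\ \tilde y_i=\emptyset\}}\ \mathbb{E}_{A_i\sim q_\phi(A\mid x_i,\tilde a_i)}\ \mathcal{F}(P_f,Y_{1:n},A_{1:n}).$$ For $s=1,\ldots,N$, $Z_s=\{(a_i^{(s)},y_i^{(s)})\}_{i=1}^n$ is a draw of $\{(A_i,Y_i)\}_{i=1}^n$ from the joint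 distribution under which all the $A_i$ and $Y_i$ ($i=1,\ldots,n$) are independent, with $A_i\sim q_\phi(A\mid x_i,\tilde a_i)$ for every $i$, $Y_i\sim P_g(Y\mid x_i)$ for every $i$ with $\tilde y_i=\emptyset$, and $Y_i=\tilde y_i$ for every $i$ with $\tilde y_i\neq\emptyset$, and $Z_1,\ldots,Z_N$ are i.i.d. The probability $P$ in the claim is over $Z_1,\ldots,Z_N$. $\log$ is the natural logarithm. *)

(* Defs.v *)
From mathcomp Require Import all_boot all_order all_algebra.
From mathcomp Require Import all_classical all_reals all_analysis.

Set Implicit Arguments.
Unset Strict Implicit.
Unset Printing Implicit Defensive.

Import Order.TTheory GRing.Theory Num.Theory.

Local Open Scope classical_set_scope.
Local Open Scope ring_scope.

Section FiniteDistributions.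
Variable R : realType.

Record fdist (T : finType) := FDist {
  pmf :> T -> R;
  pmf_ge0 : forall t, 0 <= pmf t;
  pmf_sum1 : \sum_t pmf t = 1
}.

Lemma fdist1_ge0 (T : finType) (t u : T) : 0 <= (u == t)%:R :> R.
Proof. exact: ler0n. Qed.

Lemma fdist1_sum1 (T : finType) (t : T) : \sum_u (u == t)%:R = 1 :> R.
Proof.
rewrite (bigD1 t) //= eqxx big1 ?addr0 // => u /negPf ut.
by rewrite ut.
Qed.

Definition fdist1 (T : finType) (t : T) : fdist T :=
  FDist (fdist1_ge0 t) (fdist1_sum1 t).

Lemma fdist_prod_ge0 (T U : finType) (p : fdist T) (q : fdist U) (v : T * U) :
  0 <= p v.1 * q v.2.
Proof. by rewrite mulr_ge0 ?pmf_ge0. Qed.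

Lemma fdist_prod_sum1 (T U : finType) (p : fdist T) (q : fdist U) :
  \sum_(v : T * U) p v.1 * q v.2 = 1.
Proof.
rewrite -(pair_bigA _ (fun t u => p t * q u)) /= -[RHS](pmf_sum1 p).
by apply: eq_bigr => t _; rewrite -mulr_sumr pmf_sum1 mulr1.
Qed.

Definition fdist_prod (T U : finType) (p : fdist T) (q : fdist U) :
    fdist (T * U)%type :=
  FDist (fdist_prod_ge0 p q) (fdist_prod_sum1 p q).

Lemma fdist_ffun_ge0 (I T : finType) (p : I -> fdist T) (f : {ffun I -> T}) :
  0 <= \prod_i p i (f i).
Proof. by apply: prodr_ge0 => i _; exact: pmf_ge0. Qed.

Lemma fdist_ffun_sum1 (I T : finType) (p : I -> fdist T) :
  \sum_(f : {ffun I -> T}) \prod_i p i (f i) = 1.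
Proof.
rewrite -(bigA_distr_bigA (fun i t => p i t)) /= big1 // => i _.
exact: pmf_sum1.
Qed.

Definition fdist_ffun (I T : finType) (p : I -> fdist T) :
    fdist {ffun I -> T} :=
  FDist (fdist_ffun_ge0 p) (fdist_ffun_sum1 p).

End FiniteDistributions.

Section IID.
Context {R : realType} {d : measure_display} {Omega : measurableType d}.
Variable P : probability Omega R.

(* Measurability for the discrete sigma-algebra on T; as T is finite it is
   enough to look at points. *)
Definition discrete_rv (T : finType) (X : Omega -> T) : Prop :=
  forall t, measurable (X @^-1` [set t]).

Definition has_law (T : finType) (X : Omega -> T) (mu : fdist R T) : Prop :=
  forall t, P (X @^-1` [set t]) = (mu t)%:E.

(* All subsets B i are measurable events of the finite value space T. *)
Definition mutually_independent (I T : finType) (X : I -> Omega -> T) : Prop :=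
  forall (J : {set I}) (B : I -> set T),
    P (\bigcap_(i in [set` J]) (X i @^-1` B i)) =
    (\prod_(i in J) P (X i @^-1` B i))%E.

Definition iid (I T : finType) (mu : fdist R T) (X : I -> Omega -> T) : Prop :=
  [/\ forall i, discrete_rv (X i),
      forall i, has_law (X i) mu &
      mutually_independent X].

End IID.

Section FairnessRisk.
Context {R : realType} {XT : Type} {A Y : finType} {n : nat}.

(* A classifier is seen only through P_f(Yhat | x), the law of the predicted
   label; predictions live in the same label set Y. *)
Definition classifier : Type := XT -> fdist R Y.

Definition fairness_risk : Type :=
  classifier -> {ffun 'I_n -> Y} -> {ffun 'I_n -> A} -> R.

(* F(P_f, Z) for Z = {(a_i, y_i)}_i *)
Definition risk_of_sample (F : fairness_risk) (Pf : classifier)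
    (z : {ffun 'I_n -> A * Y}) : R :=
  F Pf [ffun i => (z i).2] [ffun i => (z i).1].

Variables (x : 'I_n -> XT) (yobs : 'I_n -> option Y) (aobs : 'I_n -> option A).
(* None stands for an unavailable label or demographic. *)
Variables (q : XT -> option A -> fdist R A) (Pg : XT -> fdist R Y).

Definition label_law (i : 'I_n) : fdist R Y :=
  if yobs i is Some y then fdist1 R y else Pg (x i).

(* The joint law of {(A_i, Y_i)}_i, all 2n coordinates being independent *)
Definition sample_law : fdist R {ffun 'I_n -> A * Y} :=
  fdist_ffun (fun i => fdist_prod (q (x i) (aobs i)) (label_law i)).

Definition agrees_with_observed (y : {ffun 'I_n -> Y}) : bool :=
  [forall i, (yobs i == None) || (yobs i == Some (y i))].

(* The outer expectation is over the unobserved labels only; the observed ones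
   are kept fixed by the range condition. *)
Definition expected_risk (F : fairness_risk) (Pf : classifier) : R :=
  \sum_(y : {ffun 'I_n -> Y} | agrees_with_observed y)
    (\prod_(i | yobs i == None) Pg (x i) (y i)) *
    \sum_(a : {ffun 'I_n -> A})
      (\prod_i q (x i) (aobs i) (a i)) * F Pf y a.

Definition mc_estimator (F : fairness_risk) (Pf : classifier) (N : nat)
    (z : 'I_N -> {ffun 'I_n -> A * Y}) : R :=
  N%:R^-1 * \sum_(s < N) risk_of_sample F Pf (z s).

End FairnessRisk.

Arguments classifier : clear implicits.
Arguments fairness_risk : clear implicits.

(* Main.v *)
(* Hoeffding's inequality for the finitely supported law of one draw. With
   [m] the mean of [f : T -> [0, C]], convexity of exp on [0, C] bounds
   E exp(h (f - m)) by the moment generating function of a centred Bernoulli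
   variable with parameter [m / C], whose logarithm has second derivative
   [u (1 - u) <= 1 / 4]; hence the bound exp(h^2 C^2 / 8). Markov's inequality
   for exp(h sum), at the optimal [h = 4 eps / C^2], gives the upper tail, and
   the same for [C - f] gives the lower one. The event only depends on the
   finitely many values of the draws, so its probability is a finite sum for
   the product law; and the nested expectation defining the expected risk is
   the mean of the risk under the law of one draw. *)
Require Import Defs.
From mathcomp Require Import all_boot all_order all_algebra.
From mathcomp Require Import all_classical all_reals all_analysis.
From mathcomp Require Import ring lra.

Set Implicit Arguments.
Unset Strict Implicit.
Unset Printing Implicit Defensive.

Import Order.TTheory GRing.Theory Num.Theory.
Import numFieldNormedType.Exports.

Local Open Scope classical_set_scope.
Local Open Scope ring_scope.

(** * Calculus: the moment generating function of a Bernoulli variable *)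

Lemma ge_derive_ge0 (R : realType) (f df : R -> R) (x : R) :
  (forall t : R, is_derive t 1 f (df t)) -> (forall t, 0 <= t -> 0 <= df t) ->
  0 <= x -> f 0 <= f x.
Proof.
move=> fdf df0 x0.
have cf : {within `[0, x], continuous f}.
  apply: derivable_within_continuous => t _.
  by have [] := fdf t.
have [c /itvP c0x fx] := MVT_segment x0 (fun t _ => fdf t) cf.
by rewrite -subr_ge0 fx subr0 mulr_ge0// df0 // c0x.
Qed.

Section Bernoulli.
Variables (R : realType) (p : R).
Hypothesis p01 : 0 <= p <= 1.

(** The moment generating function of a Bernoulli variable of parameter [p]. *)
Let D (t : R) : R := 1 - p + p * expR t.

Let D_gt0 (t : R) : 0 < D t.
Proof.
rewrite /D; have := expR_gt0 t; case/andP: p01; rewrite le_eqVlt => /predU1P[<-|p0 p1 t0].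
  by lra.
by rewrite addrC ltr_wpDr ?subr_ge0// mulr_gt0.
Qed.

Let is_derive_D (t : R) : is_derive t 1 D (p * expR t).
Proof.
rewrite (_ : D = cst (1 - p) + p \*: expR); last by apply/funext.
by apply: is_derive_eq; rewrite add0r.
Qed.

(* The derivative of [p * t + t ^+ 2 / 8 - ln (D t)]. *)
Let slope (t : R) : R := p + t / 4 - p * expR t / D t.

Let slope_ge0 (t : R) : 0 <= t -> 0 <= slope t.
Proof.
(* [u t] is the parameter of the Bernoulli law exponentially tilted by [t]; its variance
   [u t * (1 - u t)] is the second derivative of [ln (D t)]. *)
move=> t0; pose u t := p * expR t / D t.
have -> : 0 = slope 0 by rewrite /slope /D expR0 mulr1 subrK divr1 mul0r addr0 subrr.
apply: (@ge_derive_ge0 R slope (fun t => 4^-1 - u t * (1 - u t)) t _ _ t0)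
    => [{t0}t|{t0}t _].
  have := is_deriveV (lt0r_neq0 (D_gt0 t)) (is_derive_D t) => dV.
  rewrite (_ : slope = cst p + 4^-1 \*: id - p \*: (expR * (fun t => (D t)^-1))).
    apply: is_derive_eq; rewrite /u /GRing.scale /=.
    have := lt0r_neq0 (D_gt0 t); rewrite /D => D0.
    by field.
  by apply/funext => y; rewrite /slope /= !fctE /= /GRing.scale /=; ring.
(* The variance is at most 1/4, by completing the square. *)
by rewrite (_ : _ - _ = (u t - 1 / 2) ^+ 2) ?sqr_ge0//; field.
Qed.

(** After taking logarithms, the gap between the two sides vanishes at 0, and so does its derivative
    [slope], which is nondecreasing; the mean value theorem is applied at both levels. *)
Lemma bernoulli_mgf_le (h : R) : 0 <= h ->
  1 - p + p * expR h <= expR (p * h + h ^+ 2 / 8).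
Proof.
move=> h0; rewrite -[leLHS]lnK ?posrE ?(D_gt0 h)// ler_expR -subr_ge0.
pose g (t : R) : R := p * t + t ^+ 2 / 8 - ln (D t).
have -> : 0 = g 0 by rewrite /g /D expR0 mulr1 subrK ln1; ring.
apply: (@ge_derive_ge0 R g slope h _ slope_ge0 h0) => {h0}t.
have dl : is_derive t 1 (@ln R \o D) ((D t)^-1 * (p * expR t)).
  have := is_derive1_ln (D_gt0 t) => dln.
  exact: is_derive1_comp.
rewrite (_ : g = p \*: id + 8^-1 \*: (id ^+ 2) - (@ln R \o D)).
  apply: is_derive_eq; rewrite /slope /GRing.scale /=.
  have := lt0r_neq0 (D_gt0 t) => D0.
  by field.
by apply/funext => y; rewrite /g /= !fctE /= /GRing.scale /=; ring.
Qed.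

End Bernoulli.

(** On the segment from 0 to [h], the convex function [expR] lies below its chord. *)
Lemma expR_chord_le (R : realType) (h u : R) :
  0 <= u <= 1 -> expR (u * h) <= 1 - u + u * expR h.
Proof.
move=> /andP[u0 u1].
have := convex_expR (Itv01 u0 u1) h (0 : R^o).
by rewrite !convRE /= mulr0 addr0 expR0 mulr1 addrC.
Qed.

Section Hoeffding.
Variables (R : realType) (T : finType) (mu : fdist R T) (C : R).
Hypothesis C_gt0 : 0 < C.

Definition fmean (f : T -> R) : R := \sum_t mu t * f t.

Lemma fmean_complement (f : T -> R) : fmean (fun t => C - f t) = C - fmean f.
Proof.
rewrite /fmean -[in RHS](mulr1 C) -(pmf_sum1 mu) mulr_sumr -sumrB.
by apply: eq_bigr => t _; rewrite mulrBr mulrC.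
Qed.

(** The chord bound at [u = f t / C] is affine in [f t], so averaging it leaves an expression in the
    mean alone: the Bernoulli moment generating function with parameter [m / C], taken at
    [h * C]. *)
Lemma hoeffding_mgf_le (f : T -> R) (h : R) :
  (forall t, 0 <= f t <= C) -> 0 <= h ->
  \sum_t mu t * expR (h * (f t - fmean f)) <= expR (h ^+ 2 * C ^+ 2 / 8).
Proof.
move=> f0C h0.
have C0 : C != 0 by rewrite gt_eqF.
set m := fmean f.
have m01 : 0 <= m / C <= 1.
  (* [Defs.pmf_ge0] is qualified: MathComp-Analysis shadows it. *)
  rewrite divr_ge0 ?(ltW C_gt0)//= ?ler_pdivrMr// ?mul1r.
    rewrite /m /fmean -[leRHS]mulr1 -(pmf_sum1 mu) mulr_sumr; apply: ler_sum => t _.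
    by rewrite [leRHS]mulrC ler_wpM2l ?Defs.pmf_ge0//; case/andP: (f0C t).
  by apply: sumr_ge0 => t _; rewrite mulr_ge0 ?Defs.pmf_ge0//; case/andP: (f0C t).
have -> : \sum_t mu t * expR (h * (f t - m)) =
          expR (- (h * m)) * \sum_t mu t * expR (f t / C * (h * C)).
  rewrite mulr_sumr; apply: eq_bigr => t _.
  rewrite mulrCA -expRD; congr (_ * expR _); by field.
apply: (@le_trans _ _ (expR (- (h * m)) * (1 - m / C + m / C * expR (h * C)))).
  rewrite ler_pM2l ?expR_gt0//.
  apply: (@le_trans _ _ (\sum_t mu t * (1 - f t / C + f t / C * expR (h * C)))).
    apply: ler_sum => t _; rewrite ler_wpM2l ?Defs.pmf_ge0// expR_chord_le//.
    by case/andP: (f0C t) => f0 fC; rewrite divr_ge0 ?(ltW C_gt0)//= ler_pdivrMr ?mul1r.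
  rewrite le_eqVlt; apply/predU1P; left; rewrite -[in RHS](pmf_sum1 mu).
  rewrite /m /fmean !mulr_suml -sumrB -big_split /=.
  by apply: eq_bigr => t _; ring.
(* The factor [expR (- (h * m))] cancels the linear term [m / C * (h * C)] of the Bernoulli
   bound. *)
rewrite -ler_pdivlMl ?expR_gt0// -expRN opprK -expRD.
apply: le_trans (bernoulli_mgf_le m01 _) _; first by rewrite mulr_ge0 ?(ltW C_gt0).
by rewrite ler_expR; rewrite le_eqVlt; apply/predU1P; left; field.
Qed.

Variables (I : finType).

Lemma hoeffding_upper_tail (f : T -> R) (eps : R) :
  (forall t, 0 <= f t <= C) -> 0 < eps ->
  \sum_(z : {ffun I -> T} | #|I|%:R * eps <= \sum_i (f (z i) - fmean f))
    \prod_i mu (z i) <= expR (- (2 * #|I|%:R * eps ^+ 2 / C ^+ 2)).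
Proof.
move=> f0C eps0.
have C0 : C != 0 by rewrite gt_eqF.
(* The minimiser of the exponent [h ^+ 2 * C ^+ 2 / 8 - h * eps]. *)
pose h := 4 * eps / C ^+ 2.
have h0 : 0 <= h by rewrite divr_ge0 ?sqr_ge0// mulr_ge0// ltW.
(* Markov: [w z] is the mass of [z] times an exponential that is at least 1 on the event and
   nonnegative elsewhere. *)
pose w (z : {ffun I -> T}) :=
  expR (- (h * (#|I|%:R * eps))) * \prod_i (mu (z i) * expR (h * (f (z i) - fmean f))).
have w0 z : 0 <= w z.
  rewrite mulr_ge0 ?expR_ge0 ?prodr_ge0// => i _.
  by rewrite mulr_ge0 ?expR_ge0 ?Defs.pmf_ge0.
apply: (@le_trans _ _ (\sum_z w z)).
  rewrite big_mkcond /=; apply: ler_sum => z _; case: ifPn => // zeps.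
  rewrite /w big_split /= -expR_sum mulrCA -expRD ler_peMr//.
    by rewrite prodr_ge0// => i _; exact: Defs.pmf_ge0.
  by rewrite -[leLHS]expR0 ler_expR -mulr_sumr -mulrN -mulrDr mulr_ge0// addrC subr_ge0.
rewrite /w -mulr_sumr.
(* Independence: the sum over vectors of a product over coordinates factors into equal one-draw
   sums. *)
rewrite -(bigA_distr_bigA (fun _ t => mu t * expR (h * (f t - fmean f)))) prodr_const.
apply: (@le_trans _ _ (expR (- (h * (#|I|%:R * eps))) *
  expR (h ^+ 2 * C ^+ 2 / 8) ^+ #|I|)).
  rewrite ler_pM2l ?expR_gt0// lerXn2r ?nnegrE ?expR_ge0//.
    by apply: sumr_ge0 => t _; rewrite mulr_ge0 ?expR_ge0 ?Defs.pmf_ge0.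
  exact: hoeffding_mgf_le.
rewrite -expRM_natl -expRD ler_expR; rewrite le_eqVlt; apply/predU1P; left; rewrite /h.
by field.
Qed.

Lemma hoeffding_two_sided (f : T -> R) (eps : R) :
  (forall t, 0 <= f t <= C) -> 0 < eps -> (0 < #|I|)%N ->
  \sum_(z : {ffun I -> T} | eps <= `| #|I|%:R^-1 * \sum_i f (z i) - fmean f |)
    \prod_i mu (z i) <= 2 * expR (- (2 * #|I|%:R * eps ^+ 2 / C ^+ 2)).
Proof.
move=> f0C eps0 I0.
have fC0C t : 0 <= C - f t <= C by case/andP: (f0C t) => ? ?; apply/andP; split; lra.
have := hoeffding_upper_tail f0C eps0; have := hoeffding_upper_tail fC0C eps0.
set b := expR _ => lower upper.
rewrite mulr_natl mulr2n; apply: le_trans (lerD upper lower).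
rewrite [leLHS]big_mkcond [X in X + _]big_mkcond [X in _ + X]big_mkcond -big_split /=.
apply: ler_sum => z _.
have p0 : 0 <= \prod_i mu (z i) by rewrite prodr_ge0// => i _; exact: Defs.pmf_ge0.
have NR : 0 < #|I|%:R :> R by rewrite ltr0n.
have S : \sum_i (f (z i) - fmean f) = #|I|%:R * (#|I|%:R^-1 * \sum_i f (z i) - fmean f).
  by rewrite sumrB sumr_const mulrBr mulVKf ?gt_eqF// mulr_natl.
have -> : \sum_i (C - f (z i) - fmean (fun t => C - f t)) =
    #|I|%:R * - (#|I|%:R^-1 * \sum_i f (z i) - fmean f).
  rewrite mulrN -S -[RHS](sumrN _ _ (fun i => f (z i) - fmean f)).
  by apply: eq_bigr => i _; rewrite fmean_complement; ring.
rewrite S !ler_pM2l// ler_normr.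
(* Pointwise union bound for the two tails. *)
by case: (eps <= _); case: (eps <= _) => /=; rewrite ?addr0 ?add0r ?lerDl.
Qed.

End Hoeffding.

(** * From random variables to finite sums *)

Lemma iid_joint_probability (R : realType) (d : measure_display)
    (Omega : measurableType d) (P : probability Omega R) (I T : finType)
    (mu : fdist R T) (X : I -> Omega -> T) (Q : pred {ffun I -> T}) :
  iid P mu X ->
  P [set w | Q [ffun i => X i w]] =
  (\sum_(z : {ffun I -> T} | Q z) \prod_i mu (z i))%:E.
Proof.
move=> [mX lawX indX].
(* [E z] prescribes every draw. These cylinders are disjoint, the event is the finite union of those
   with [Q z], and independence turns the probability of each into a product. *)
pose E (z : {ffun I -> T}) := \bigcap_(i in [set` [set: I]%SET]) (X i @^-1` [set z i]).
have EE z : E z = [set w | [ffun i => X i w] = z].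
  apply/seteqP; split => [w Ew|w <- i _]; last by rewrite /= ffunE.
  by apply/ffunP => i; rewrite ffunE; apply: Ew; rewrite /= inE.
have -> : [set w | Q [ffun i => X i w]] = \bigcup_(z in [set` Q]) E z.
  apply/seteqP; split => [w Qw|w [z Qz]]; last by rewrite EE /= => ->.
  by exists [ffun i => X i w]; rewrite ?EE.
rewrite measure_fin_bigcup//; last 2 first.
- by move=> z z' _ _ [w []]; rewrite !EE /= => <- <-.
- move=> z _; apply: fin_bigcap_measurable => // i _; exact: mX.
rewrite (_ : [set` Q] = [set` enum Q]); last first.
  by apply/seteqP; split => z /=; rewrite mem_enum.
rewrite -fsbig_seq ?enum_uniq// big_enum -sumEFin; apply: eq_bigr => z _.
rewrite [LHS](indX _ (fun i => [set z i])) -prodEFin; under eq_bigl do rewrite inE.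
by apply: eq_bigr => i _; exact: lawX.
Qed.

(** Pairing a label vector with a demographic vector coordinatewise is a bijection onto samples,
    under which the product law splits into the two nested weights. *)
Lemma expected_riskE (R : realType) (XT : Type) (A Y : finType) (n : nat)
    (x : 'I_n -> XT) (yobs : 'I_n -> option Y) (aobs : 'I_n -> option A)
    (q : XT -> option A -> fdist R A) (Pg : XT -> fdist R Y)
    (F : fairness_risk R XT A Y n) (Pf : classifier R XT Y) :
  expected_risk x yobs aobs q Pg F Pf =
  fmean (sample_law x yobs aobs q Pg) (risk_of_sample F Pf).
Proof.
pose zip (ya : {ffun 'I_n -> Y} * {ffun 'I_n -> A}) : {ffun 'I_n -> A * Y} :=
  [ffun i => (ya.2 i, ya.1 i)].
pose unzip (z : {ffun 'I_n -> A * Y}) : {ffun 'I_n -> Y} * {ffun 'I_n -> A} :=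
  ([ffun i => (z i).2], [ffun i => (z i).1]).
have zipK : cancel zip unzip.
  by move=> [y a]; congr pair; apply/ffunP => i; rewrite !ffunE.
have unzipK : cancel unzip zip.
  by move=> z; apply/ffunP => i; rewrite !ffunE /=; case: (z i).
rewrite /fmean (reindex zip) /=; last by exists unzip => z _.
rewrite -(pair_bigA _ (fun y a => sample_law x yobs aobs q Pg (zip (y, a)) *
  risk_of_sample F Pf (zip (y, a)))) /=.
rewrite /expected_risk big_mkcond /=; apply: eq_bigr => y _.
(* The point masses at the observed labels multiply to the indicator of agreement, which is the
   range condition of the outer sum. *)
have lawE : \prod_i label_law x yobs Pg i (y i) =
    if agrees_with_observed yobs y then \prod_(i | yobs i == None) Pg (x i) (y i)
    else 0.
  case: ifPn => [/forallP agr|/forallPn[i]].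
    rewrite [RHS]big_mkcond; apply: eq_bigr => i _.
    have := agr i; rewrite /label_law; case: (yobs i) => //= y' /eqP[->].
    by rewrite eqxx.
  rewrite negb_or => /andP[yi yyi]; rewrite (bigD1 i)//= /label_law.
  move: yi yyi; case: (yobs i) => //= y' _ yy'.
  by rewrite (_ : (y i == y') = false) ?mul0r//; apply: contraNF yy' => /eqP->.
have -> : \sum_(a : {ffun 'I_n -> A}) sample_law x yobs aobs q Pg (zip (y, a)) *
      risk_of_sample F Pf (zip (y, a)) =
    (\prod_i label_law x yobs Pg i (y i)) *
    \sum_(a : {ffun 'I_n -> A}) (\prod_i q (x i) (aobs i) (a i)) * F Pf y a.
  rewrite mulr_sumr; apply: eq_bigr => a _.
  rewrite /risk_of_sample mulrA; congr (_ * F Pf _ _).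
  - by rewrite -big_split; apply: eq_bigr => i _; rewrite /= !ffunE mulrC.
  - by apply/ffunP => i; rewrite !ffunE.
  - by apply/ffunP => i; rewrite !ffunE.
by rewrite lawE; case: ifP => _; rewrite ?mul0r.
Qed.

Theorem theorem1 (R : realType) (XT : Type) (A Y : finType) (n : nat)
    (x : 'I_n -> XT) (yobs : 'I_n -> option Y) (aobs : 'I_n -> option A)
    (Pf : classifier R XT Y) (F : fairness_risk R XT A Y n)
    (q : XT -> option A -> fdist R A) (Pg : XT -> fdist R Y)
    (C : R) (C_gt0 : 0 < C)
    (F_bounded : forall y a, 0 <= F Pf y a <= C) :
  (forall (N : nat) (d : measure_display) (Omega : measurableType d)
      (P : probability Omega R) (Z : 'I_N -> Omega -> {ffun 'I_n -> A * Y}),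
    (0 < N)%N ->
    iid P (sample_law x yobs aobs q Pg) Z ->
    forall eps : R, 0 < eps ->
      (P [set w | (eps <= `| mc_estimator F Pf (Z^~ w)
                             - expected_risk x yobs aobs q Pg F Pf |)%R]
       <= (2 * expR (- (2 * N%:R * eps ^+ 2 / C ^+ 2)))%:E)%E) /\
  (forall (eps delta : R), 0 < eps -> 0 < delta < 1 ->
    forall (N : nat) (d : measure_display) (Omega : measurableType d)
      (P : probability Omega R) (Z : 'I_N -> Omega -> {ffun 'I_n -> A * Y}),
    N%:Z = Num.ceil (C ^+ 2 / (2 * eps ^+ 2) * ln (2 / delta)) ->
    iid P (sample_law x yobs aobs q Pg) Z ->
      (P [set w | (eps <= `| mc_estimator F Pf (Z^~ w)
                             - expected_risk x yobs aobs q Pg F Pf |)%R]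
       <= delta%:E)%E).
Proof.
have tail (N : nat) (d : measure_display) (Omega : measurableType d)
    (P : probability Omega R) (Z : 'I_N -> Omega -> {ffun 'I_n -> A * Y})
    (eps : R) : (0 < N)%N -> iid P (sample_law x yobs aobs q Pg) Z -> 0 < eps ->
  (P [set w | (eps <= `| mc_estimator F Pf (Z^~ w)
                         - expected_risk x yobs aobs q Pg F Pf |)%R]
   <= (2 * expR (- (2 * N%:R * eps ^+ 2 / C ^+ 2)))%:E)%E.
  move=> N0 iidZ eps0.
  have riskC z : 0 <= risk_of_sample F Pf z <= C by exact: F_bounded.
  pose Q (z : {ffun 'I_N -> {ffun 'I_n -> A * Y}}) :=
    eps <= `| N%:R^-1 * \sum_s risk_of_sample F Pf (z s) -
      fmean (sample_law x yobs aobs q Pg) (risk_of_sample F Pf) |.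
  rewrite (_ : [set w | _] = [set w | Q [ffun s => Z s w]]).
    rewrite (iid_joint_probability _ iidZ) lee_fin.
    have := hoeffding_two_sided (sample_law x yobs aobs q Pg) C_gt0
      (I := 'I_N) riskC eps0.
    by rewrite card_ord; apply.
  rewrite expected_riskE /mc_estimator; apply/funext => w; rewrite /Q /=.
  by under [in RHS]eq_bigr do rewrite ffunE.
split=> [N d Omega P Z N0 iidZ eps eps0|]; first exact: tail.
move=> eps delta eps0 /andP[d0 d1] N d Omega P Z NE iidZ.
have e2 : 0 < 2 * eps ^+ 2 by rewrite mulr_gt0// exprn_gt0.
have C2 : 0 < C ^+ 2 by rewrite exprn_gt0.
(* Positivity of the threshold makes its ceiling a nonzero sample size, as [tail] requires. *)
have ln0 : 0 < ln (2 / delta) by rewrite ln_gt0// ltr_pdivlMr// mul1r; lra.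
have leN : C ^+ 2 / (2 * eps ^+ 2) * ln (2 / delta) <= N%:R.
  by rewrite -[N%:R]/(N%:Z%:~R) NE ceil_ge.
have N0 : (0 < N)%N.
  by rewrite -(ltr0n R); apply: lt_le_trans leN; rewrite mulr_gt0// divr_gt0.
apply: le_trans (tail _ _ _ _ _ _ N0 iidZ eps0) _; rewrite lee_fin.
(* In logarithms the goal is [ln (2 / delta) <= 2 * N%:R * eps ^+ 2 / C ^+ 2], a rearrangement of
   [leN]. *)
rewrite -ler_pdivlMl// [leRHS]mulrC -ler_ln ?posrE ?expR_gt0 ?divr_gt0// expRK.
rewrite -[delta / 2]invf_div lnV ?posrE ?divr_gt0// lerN2 ler_pdivlMr//.
move: leN; rewrite mulrAC ler_pdivrMr// mulrC => /le_trans; apply.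
by rewrite mulrCA mulrA.
Qed.
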